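(* Let $\mathcal{V}$ be a (complex) locally convex topological vector space which has the factorization property. Let $M_0,M_1,\ldots$ be an infinite sequence of elements of $\mathbf{L}(\mathcal{V},\mathcal{V}^* )$ such that for every $N=0,1,2,\ldots$ the Toeplitz operator matrix $$\mathbb{M}_N=\begin{pmatrix} \frac{M_0+M_0^*|_{\mathcal V}}{2}&M_1&M_2&\cdots &M_N\\ M_1^*|_{\mathcal V}&\frac{M_0+M_0^*|_{\mathcal V}}{2}&M_1&\cdots&M_{N-1}\\ M_2^*|_{\mathcal V}&M_1^*|_{\mathcal V}&\frac{M_0+M_0^*|_{\mathcal V}}{2}&\cdots&M_{N-2}\\ \vdots&\vdots&\vdots &\ddots &\vdots\\ M_N^*|_{\mathcal V}&M_{N-1}^*|_{\mathcal V}&M_{N-2}^*|_{\mathcal V}&\cdots &\frac{M_0+M_0^*|_{\mathcal V}}{2} \end{pmatrix}$$ is a positive operator from $\mathcal{V}^{N+1}$ into $(\mathcal{V}^* )^{N+1}$. Then for every $z$ in the open unit disk $\mathbb{D}$ the series $$\Phi(z)=M_0+2\sum_{n=1}^\infty z^nM_n$$ converges weakly, and the resulting function $\Phi$ is a Carathéodory-Herglotz function, i.e. $\Phi\in\mathcal{C}(\mathcal{V},\mathcal{V}^* )$. Furthermore, there exist a Hilbert space $\mathcal{H}_0$, an operator $T_0\in\mathbf{L}(\mathcal{V},\mathcal{H}_0)$ with dense range and a function $\varphi\in\mathcal{C}(\mathcal{H}_0)$ such that $$\Phi(z)=\frac{\Phi(0)-\Phi(0)^*|_{\mathcal V}}{2}+T_0^*\varphi(z)T_0,\qquad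 z\in\mathbb{D}.$$ Conversely, every function of the form $$\Phi(z)=D+T^*\varphi(z)T,\qquad z\in\mathbb{D},$$ where $D\in\mathbf{L}(\mathcal{V},\mathcal{V}^* )$ is purely imaginary, $T\in\mathbf{L}(\mathcal{V},\mathcal{H})$ for some Hilbert space $\mathcal{H}$ with $\overline{\operatorname{ran}(T)}=\mathcal{H}$, and $\varphi\in\mathcal{C}(\mathcal{H})$, belongs to $\mathcal{C}(\mathcal{V},\mathcal{V}^* )$.
   Context: Vector spaces are complex; Hilbert spaces need not be separable, and their inner products are linear in the first variable. For a locally convex topological vector space $\mathcal{V}$, $\mathcal{V}^*$ is the space of antilinear continuous functionals on $\mathcal{V}$, and $\langle f,v\rangle_{\mathcal V}=f(v)$ denotes the duality between $f\in\mathcal{V}^*$ and $v\in\mathcal{V}$ (linear in $f$, antilinear in $v$). $\mathcal{V}^*$ carries the topology of pointwise convergence on $\mathcal{V}$ (weak-$*$ topology). $\mathbf{L}(\mathcal{V},\mathcal{W})$ is the space of continuous linear operators from $\mathcal{V}$ to $\mathcal{W}$, and $\mathbf{L}(\mathcal{H})$ is the space of bounded operators on a Hilbert space $\mathcal{H}$; a Hilbert space is identified with its antilinear dual through the inner product. For $A\in\mathbf{L}(\mathcal{V},\mathcal{V}^* )$, $A^*|_{\mathcal V}:\mathcal{V}\to\mathcal{V}^*$ is defined by $\langle A^*|_{\mathcal V}v,w\rangle_{\mathcal V}=\overline{\langle Aw,v\rangle_{\mathcal V}}$ for $v,w\in\mathcal{V}$. For $T\in\mathbf{L}(\mathcal{V},\mathcal{H})$,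 $\mathcal{H}$ a Hilbert space, $T^*:\mathcal{H}\to\mathcal{V}^*$ is defined by $\langle T^*h,v\rangle_{\mathcal V}=\langle h,Tv\rangle_{\mathcal H}$. An operator $A\in\mathbf{L}(\mathcal{V},\mathcal{V}^* )$ is positive ($A\ge0$) if $\langle Av,v\rangle_{\mathcal V}\ge 0$ for all $v\in\mathcal{V}$; it is purely imaginary if $A+A^*|_{\mathcal V}=0$. The space $\mathcal{V}$ has the factorization property if every $A\ge 0$ in $\mathbf{L}(\mathcal{V},\mathcal{V}^* )$ can be written $A=T^*T$ with $T$ a continuous operator from $\mathcal{V}$ into some Hilbert space (depending on $A$). The dual of $\mathcal{V}^{N}$ (product topology) is identified with $(\mathcal{V}^* )^{N}$ via $\langle (f_i),(v_i)\rangle_{\mathcal{V}^N}=\sum_i\langle f_i,v_i\rangle_{\mathcal V}$; positivity of operators from $\mathcal{V}^N$ into $(\mathcal{V}^* )^N$ is understood accordingly. A function $K(z,w)$ on $\mathbb{D}\times\mathbb{D}$ with values linear operators $\mathcal{V}\to\mathcal{V}^*$ is a positive kernel if for all $n\in\mathbb{N}$, $z_1,\dots,z_n\in\mathbb{D}$, $v_1,\dots,v_n\in\mathcal{V}$ the $n\times n$ matrix with $(\ell,j)$ entry $\langle K(z_\ell,z_j)v_j,v_\ell\rangle_{\mathcal V}$ is positive semidefinite. A function $\Phi:\mathbb{D}\to\mathbf{L}(\mathcal{V},\mathcal{V}^* )$ (no analyticity assumed a priori) is a Carathéodory-Herglotz function if the kernel $$K_\Phi(z,w)=\frac{\Phi(z)+\Phi(w)^*|_{\mathcal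 V}}{1-z\overline{w}}$$ is positive in $\mathbb{D}$. The set of such functions is $\mathcal{C}(\mathcal{V},\mathcal{V}^* )$; when $\mathcal{V}$ is a Hilbert space $\mathcal{H}$ it is denoted $\mathcal{C}(\mathcal{H})$ (functions with values in $\mathbf{L}(\mathcal{H})$). Weak convergence of the series means that $\langle M_0v,w\rangle_{\mathcal V}+2\sum_{n\ge1}z^n\langle M_nv,w\rangle_{\mathcal V}$ converges for all $v,w\in\mathcal{V}$, its sum being $\langle\Phi(z)v,w\rangle_{\mathcal V}$. *)

(* Defs.v *)
From HB Require Import structures.
From mathcomp Require Import all_boot all_order all_algebra.
From mathcomp Require Import all_classical all_reals all_analysis.
From mathcomp Require Import sesquilinear complex.

Set Implicit Arguments.
Unset Strict Implicit.
Unset Printing Implicit Defensive.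

Import Order.TTheory GRing.Theory Num.Theory.
Import numFieldNormedType.Exports.

Local Open Scope classical_set_scope.
Local Open Scope ring_scope.

(* The inner product is linear in its first argument and antilinear in the
   second one: this is the convention of {dot _ for _}. *)
HB.mixin Record isHilbert (R : realType) H & CompleteNormedModule R[i] H := {
  hdot : {dot H for (@Num.conj R[i])} ;
  hdot_norm : forall x : H, `|x| ^+ 2 = hdot x x
}.

#[short(type="hilbertType")]
HB.structure Definition Hilbert (R : realType) :=
  {H of CompleteNormedModule R[i] H & isHilbert R H}.

Section ContinuousLinear.
Variable R : realType.
Local Notation C := R[i].

Lemma continuous_lincomb (V : topologicalType) (W : topologicalLmodType C)
    (k : V -> C^o) (f g : V -> W) :
  continuous k -> continuous f -> continuous g ->
  continuous (fun x => k x *: f x + g x).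
Proof.
move=> ck cf cg x.
apply: (@continuous_comp _ _ _ (fun x => (k x *: f x, g x))
  (fun p : W * W => p.1 + p.2)); last exact: add_continuous.
apply: cvg_pair; last exact: cg.
apply: (@continuous_comp V (C^o * W)%type W (fun x => (k x, f x))
  (fun p => p.1 *: p.2)); last exact: scale_continuous.
by apply: (@cvg_pair _ _ _ _ (nbhs (k x : C^o))); [exact: ck|exact: cf].
Qed.

Section Def.
Variables (V W : topologicalLmodType C).

Definition contlin_pred : {pred V -> W} :=
  fun f => `[< linear f /\ continuous f >].

Record contlin := ContLin {
  contlin_fun :> V -> W ;
  _ : contlin_fun \in contlin_pred }.

HB.instance Definition _ := [isSub for contlin_fun].
HB.instance Definition _ := [Choice of contlin by <:].

Lemma contlin_submod_closed : submod_closed contlin_pred.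
Proof.
split.
  apply/asboolP; split=> [a u v|x]; first by rewrite /= scaler0 addr0.
  exact: cvg_cst.
move=> a f g /asboolP[lf cf] /asboolP[lg cg]; apply/asboolP; split.
  move=> b u v /=.
  have -> x : (a *: f + g) x = a *: f x + g x by [].
  have -> x : (a *: f + g) x = a *: f x + g x by [].
  by rewrite lf lg !scalerDr !scalerA [a * b]mulrC addrACA.
by apply: continuous_lincomb => //; exact: cst_continuous.
Qed.

HB.instance Definition _ :=
  GRing.isSubmodClosed.Build _ _ contlin_pred contlin_submod_closed.
HB.instance Definition _ := [SubChoice_isSubLmodule of contlin by <:].

End Def.
End ContinuousLinear.

Notation "''L' ( V , W )" := (contlin V W)
  (at level 8, format "''L' ( V ,  W )") : type_scope.

Section ContinuousLinearTheory.
Variable R : realType.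
Local Notation C := R[i].

Lemma contlin_linear (V W : topologicalLmodType C) (A : 'L(V, W)) : linear A.
Proof. by have /asboolP[] := valP A. Qed.

HB.instance Definition _ (V W : topologicalLmodType C) (A : 'L(V, W)) :=
  GRing.isLinear.Build C V W *:%R (contlin_fun A) (contlin_linear A).

Lemma contlin_continuous (V W : topologicalLmodType C) (A : 'L(V, W)) :
  continuous A.
Proof. by have /asboolP[] := valP A. Qed.

Lemma comp_contlin_subproof (V W X : topologicalLmodType C)
    (B : 'L(W, X)) (A : 'L(V, W)) :
  (fun v => B (A v)) \in @contlin_pred R V X.
Proof.
apply/asboolP; split=> [a u v|x]; first by rewrite !linearP.
by apply: (@continuous_comp V W X); exact: contlin_continuous.
Qed.

Definition comp_contlin (V W X : topologicalLmodType C)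
    (B : 'L(W, X)) (A : 'L(V, W)) : 'L(V, X) :=
  ContLin (comp_contlin_subproof B A).

Lemma id_contlin_subproof (V : topologicalLmodType C) :
  (fun v : V => v) \in @contlin_pred R V V.
Proof. by apply/asboolP; split=> [a u v|x]; [|exact: cvg_id]. Qed.

Definition id_contlin (V : topologicalLmodType C) : 'L(V, V) :=
  ContLin (id_contlin_subproof V).

End ContinuousLinearTheory.

Notation "B \oL A" := (comp_contlin B A)
  (at level 40, left associativity, format "B  \oL  A") : ring_scope.

Section Antidual.
Variable R : realType.
Local Notation C := R[i].

Section Def.
Variable V : topologicalLmodType C.

Definition antidual_pred : {pred V -> C^o} :=
  fun f => `[< linear_for (Num.conj \; *%R) f /\ continuous f >].

(* antidual V carries the weak-* topology, i.e. the topology of pointwise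
   convergence on V. *)
Record antidual := Antidual {
  antidual_fun : V -> C^o ;
  _ : antidual_fun \in antidual_pred }.

HB.instance Definition _ := [isSub for antidual_fun].
HB.instance Definition _ := [Choice of antidual by <:].

Lemma antidual_submod_closed : submod_closed antidual_pred.
Proof.
split.
  apply/asboolP; split=> [a u v|x]; first by rewrite /= mulr0 addr0.
  exact: cvg_cst.
move=> a f g /asboolP[lf cf] /asboolP[lg cg]; apply/asboolP; split.
  move=> b u v /=.
  have E x : (a *: f + g) x = a * f x + g x by [].
  by rewrite !E lf lg /= !mulrDr !mulrA [a * b^*]mulrC addrACA.
have ca : continuous ((fun=> a) : V -> C^o) by exact: cst_continuous.
have /= := continuous_lincomb ca cf cg.
by [].
Qed.

HB.instance Definition _ :=
  GRing.isSubmodClosed.Build _ _ antidual_pred antidual_submod_closed.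
HB.instance Definition _ := [SubChoice_isSubLmodule of antidual by <:].

Definition antidual_eval (f : antidual) (v : V) : C := antidual_fun f v.

HB.instance Definition _ := Topological.copy antidual
  (initial_topology (antidual_fun : antidual -> {ptws V -> C^o})).

Lemma antidual_evalE (f : antidual) a u v :
  antidual_eval f (a *: u + v) = a^* * antidual_eval f u + antidual_eval f v.
Proof. by have /asboolP[lf _] := valP f; exact: lf. Qed.

Lemma antidual_eval_continuous (f : antidual) :
  continuous (antidual_eval f : V -> C^o).
Proof. by have /asboolP[] := valP f. Qed.

Lemma cvg_antidual T (F : set_system T) {FF : Filter F}
    (g : T -> antidual) (f : antidual) :
  (forall v, (fun t => antidual_eval (g t) v : C^o) @ F
     --> (antidual_eval f v : C^o)) ->
  g @ F --> f.
Proof.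
move=> gf U [_ [[W oW <-] Wf] WU]; apply: filterS WU _.
suff : (fun t => antidual_fun (g t) : {ptws V -> C^o}) @ F
    --> (antidual_fun f : {ptws V -> C^o}).
  by apply; exact: open_nbhs_nbhs.
apply/cvg_sup => v N [_ [[A oA <-] Av] AN].
apply: filterS AN _; apply: (gf v); exact: open_nbhs_nbhs.
Qed.

Lemma eval_continuous v : continuous (antidual_eval^~ v : antidual -> C^o).
Proof.
move=> f; apply: (@continuous_comp antidual {ptws V -> C^o} C^o
  (fun f => antidual_fun f) (fun g => g v)).
  exact: (@initial_continuous antidual {ptws V -> C^o} antidual_fun).
exact: (@proj_continuous {classic V} (fun=> C^o) v).
Qed.

Lemma antidual_add_continuous :
  continuous (fun x : antidual * antidual => x.1 + x.2).
Proof.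
move=> fg; apply: cvg_antidual => v.
have c1 : continuous ((fun=> 1) : antidual * antidual -> C^o).
  exact: cst_continuous.
have ce (p : antidual * antidual -> antidual) : continuous p ->
    continuous (fun x => antidual_eval (p x) v : C^o).
  move=> cp x; exact: (@continuous_comp _ _ _ p
    (antidual_eval^~ v : antidual -> C^o) x (cp x) (@eval_continuous v _)).
have cfst : continuous (fun x : antidual * antidual => x.1).
  by move=> x; exact: cvg_fst.
have csnd : continuous (fun x : antidual * antidual => x.2).
  by move=> x; exact: cvg_snd.
have := continuous_lincomb c1 (ce _ cfst) (ce _ csnd).
rewrite (_ : (fun x => _) = fun x : antidual * antidual =>
  antidual_eval (x.1 + x.2) v : C^o); first exact.
by apply/funext => x; rewrite scale1r.
Qed.

Lemma antidual_scale_continuous :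
  continuous (fun x : C^o * antidual => x.1 *: x.2).
Proof.
move=> af; apply: cvg_antidual => v.
have ck : continuous (fun x : C^o * antidual => x.1 : C^o).
  by move=> x; exact: cvg_fst.
have cf : continuous (fun x : C^o * antidual => antidual_eval x.2 v : C^o).
  move=> x; apply: (@continuous_comp _ _ _
    (fun x : C^o * antidual => x.2) (antidual_eval^~ v : antidual -> C^o)).
    exact: cvg_snd.
  exact: eval_continuous.
have c0 : continuous ((fun=> 0) : C^o * antidual -> C^o).
  exact: cst_continuous.
have := continuous_lincomb ck cf c0.
rewrite (_ : (fun x => _) = fun x : C^o * antidual =>
  antidual_eval (x.1 *: x.2) v : C^o); first exact.
by apply/funext => x; rewrite addr0.
Qed.

HB.instance Definition _ := PreTopologicalNmodule_isTopologicalNmodule.Build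
  antidual antidual_add_continuous.
HB.instance Definition _ := TopologicalNmodule_isTopologicalLmodule.Build
  C antidual antidual_scale_continuous.

End Def.
End Antidual.

Coercion antidual_eval : antidual >-> Funclass.
Section Adjoints.
Variable R : realType.
Local Notation C := R[i].

Lemma conj_continuous : continuous (Num.conj : C^o -> C^o).
Proof.
move=> x U /= [e e0 eU]; exists e => //= y xy; apply: eU.
by rewrite /= -rmorphB norm_conjC.
Qed.

Lemma hdot_CauchySchwarz (H : hilbertType R) (x y : H) :
  `|hdot x y| <= `|x| * `|y|.
Proof.
rewrite -(@ler_pXn2r _ 2) ?nnegrE ?mulr_ge0// exprMn !hdot_norm.
have [->|y0] := eqVneq y 0.
  by rewrite linear0r normr0 expr0n/= mulr_ge0 ?dnorm_ge0.
have n0 : 0 < hdot y y by rewrite dnorm_gt0.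
have nr : (hdot y y)^-1^* = (hdot y y)^-1.
  by rewrite conj_Creal// gtr0_real// invr_gt0.
set d := hdot x y; set n := hdot y y in n0 nr *.
have := dnorm_ge0 hdot (x - (d / n) *: y).
rewrite dnormB dnormZ linearZr_LR/= -/n -/d.
have E : (d / n)^* * d = `|d| ^+ 2 / n.
  by rewrite rmorphM/= nr mulrAC normCK [d^* * d]mulrC.
have -> : `|d / n| ^+ 2 * n = `|d| ^+ 2 / n.
  rewrite normrM normfV (gtr0_norm n0) exprMn -mulrA; congr (_ * _).
  by rewrite expr2 mulfVK ?gt_eqF.
rewrite E rmorphM rmorphXn/= conj_Creal ?normr_real// nr.
by rewrite addrKA subr_ge0 ler_pdivrMr.
Qed.

Lemma hdot_continuousl (H : hilbertType R) (y : H) :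
  continuous (fun x : H => hdot x y : C^o).
Proof.
move=> x; apply/(@cvgrPdist_lt _ C^o) => e e0; near=> z.
rewrite -linearBl/= (le_lt_trans (hdot_CauchySchwarz _ _))//.
have y1 : 0 < `|y| + 1 by rewrite ltr_wpDl.
rewrite (@le_lt_trans _ _ (`|x - z| * (`|y| + 1)))//.
  by rewrite ler_wpM2l// lerDl.
rewrite -ltr_pdivlMr//; near: z.
by apply: (@cvgr_dist_lt _ H); rewrite ?divr_gt0.
Unshelve. all: by end_near. Qed.

Lemma hdot_continuousr (H : hilbertType R) (x : H) :
  continuous (fun y : H => hdot x y : C^o).
Proof.
have -> : (fun y => hdot x y) = (fun y => (hdot y x)^*).
  by apply/funext => y; rewrite hermC expr0 mul1r.
move=> y; apply: (@continuous_comp H C^o C^o (fun y => hdot y x)).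
  exact: hdot_continuousl.
exact: conj_continuous.
Qed.

Lemma dual_adj_antidual (V : topologicalLmodType C) (A : 'L(V, antidual V))
    (v : V) :
  (fun w => (A w v)^*) \in @antidual_pred R V.
Proof.
apply/asboolP; split=> [a u w|w] /=.
  by rewrite linearP/= -rmorphM -rmorphD.
apply: (@continuous_comp V C^o C^o (fun w => A w v)); last first.
  exact: conj_continuous.
apply: (@continuous_comp V (antidual V) C^o A (fun f => f v)).
  exact: contlin_continuous.
exact: eval_continuous.
Qed.

Lemma dual_adj_contlin (V : topologicalLmodType C) (A : 'L(V, antidual V)) :
  (fun v => Antidual (dual_adj_antidual A v)) \in @contlin_pred R V (antidual V).
Proof.
apply/asboolP; split=> [a u v|v].
  apply/val_inj/funext => w /=.
  by rewrite antidual_evalE rmorphD rmorphM/= conjCK.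
apply: cvg_antidual => w.
apply: (@continuous_comp V C^o C^o (fun v => A w v)).
  exact: antidual_eval_continuous.
exact: conj_continuous.
Qed.

(* The operator written A^*|_V, see dual_adjE. *)
Definition dual_adj (V : topologicalLmodType C) (A : 'L(V, antidual V)) :
  'L(V, antidual V) := ContLin (dual_adj_contlin A).

Lemma hadj_antidual (V : topologicalLmodType C) (H : hilbertType R)
    (T : 'L(V, H)) (h : H) :
  (fun v => hdot h (T v)) \in @antidual_pred R V.
Proof.
apply/asboolP; split=> [a u w|w] /=.
  by rewrite linearP/= linearDr linearZr_LR.
apply: (@continuous_comp V H C^o T); last exact: hdot_continuousr.
exact: contlin_continuous.
Qed.

Lemma hadj_contlin (V : topologicalLmodType C) (H : hilbertType R)
    (T : 'L(V, H)) :
  (fun h => Antidual (hadj_antidual T h)) \in @contlin_pred R H (antidual V).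
Proof.
apply/asboolP; split=> [a u v|h].
  by apply/val_inj/funext => w /=; rewrite linearPl.
by apply: cvg_antidual => w; exact: hdot_continuousl.
Qed.

(* The operator written T^*, see hadjE. *)
Definition hadj (V : topologicalLmodType C) (H : hilbertType R)
  (T : 'L(V, H)) : 'L(H, antidual V) := ContLin (hadj_contlin T).

End Adjoints.

Lemma dual_adjE (R : realType) (V : topologicalLmodType R[i])
    (A : 'L(V, antidual V)) (v w : V) :
  dual_adj A v w = (A w v)^*.
Proof. by []. Qed.

Lemma hadjE (R : realType) (V : topologicalLmodType R[i]) (H : hilbertType R)
    (T : 'L(V, H)) (h : H) (v : V) :
  hadj T h v = hdot h (T v).
Proof. by []. Qed.

Section Positivity.
Variable R : realType.
Local Notation C := R[i].

Definition positive_op (V : topologicalLmodType C) (A : 'L(V, antidual V)) :=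
  forall v, 0 <= A v v.

Definition purely_imaginary (V : topologicalLmodType C)
  (A : 'L(V, antidual V)) := A + dual_adj A = 0.

Definition factorization_property (V : tvsType C) :=
  forall A : 'L(V, antidual V), positive_op A ->
    exists (H : hilbertType R) (T : 'L(V, H)), A = hadj T \oL T.

(* A block operator from V^n to (antidual V)^n is continuous for the product
   topologies since its entries are. The duality between (antidual V)^n and V^n
   is the sum of the componentwise dualities. *)
Definition block_op (V : topologicalLmodType C) n
    (A : 'M['L(V, antidual V)]_n) (v : 'I_n -> V) : 'I_n -> antidual V :=
  fun i => \sum_(j < n) A i j (v j).

Definition block_positive (V : topologicalLmodType C) n
    (A : 'M['L(V, antidual V)]_n) :=
  forall v : 'I_n -> V, 0 <= \sum_(i < n) block_op A v i (v i).

Definition toeplitz (V : topologicalLmodType C)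
    (M : nat -> 'L(V, antidual V)) N : 'M['L(V, antidual V)]_N.+1 :=
  \matrix_(i, j)
    if (i < j)%N then M (j - i)%N
    else if (j < i)%N then dual_adj (M (i - j)%N)
    else 2^-1 *: (M 0%N + dual_adj (M 0%N)).

Definition unit_disk : set C := [set z | `|z| < 1].

(* The order of C makes the quadratic form real-valued, so that such a matrix
   is Hermitian. *)
Definition psdmx n (A : 'M[C]_n) :=
  forall c : 'cV[C]_n, 0 <= \sum_(l < n) \sum_(j < n) (c l 0)^* * A l j * c j 0.

Definition positive_kernel (V : topologicalLmodType C)
    (K : C -> C -> {linear V -> antidual V}) :=
  forall n (z : 'I_n -> C) (v : 'I_n -> V), (forall i, unit_disk (z i)) ->
    psdmx (\matrix_(l < n, j < n) K (z l) (z j) (v j) (v l)).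

Definition herglotz_kernel (V : topologicalLmodType C)
    (Phi : C -> 'L(V, antidual V)) (z w : C) : 'L(V, antidual V) :=
  (1 - z * w^*)^-1 *: (Phi z + dual_adj (Phi w)).

(* Functions on the unit disk are represented by total functions on C, whose
   values outside of the disk are never used. *)
Definition caratheodory_herglotz (V : topologicalLmodType C)
    (Phi : C -> 'L(V, antidual V)) :=
  positive_kernel (fun z w => herglotz_kernel Phi z w).

(* The identification of H with its antilinear dual: h is mapped to the
   functional hdot h. *)
Definition riesz (H : hilbertType R) : 'L(H, antidual H) :=
  hadj (id_contlin H).

Definition caratheodory_herglotz_hilbert (H : hilbertType R)
    (phi : C -> 'L(H, H)) :=
  caratheodory_herglotz (fun z => riesz H \oL phi z).

Definition weak_sum (V : topologicalLmodType C)
    (M : nat -> 'L(V, antidual V)) (z : C) (S : 'L(V, antidual V)) :=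
  forall v w : V,
    (fun k => M 0%N v w + 2 * \sum_(1 <= n < k) z ^+ n * M n v w : C^o) @ \oo
      --> (S v w : C^o).

End Positivity.

(* Main.v *)
(* Positivity of the 1 x 1 Toeplitz matrix makes A = (M_0 + M_0^* )/2 positive,
   so A = T^* T by the factorization property, and T may be taken with dense
   range after replacing its target by the closure of its range. The 2 x 2
   minors give |<M_n v, w>| <= |T v| |T w|, hence the series converges and
   <A v, w> + 2 sum z^n <M_n v, w> is a bounded form in (T v, T w); by the Riesz
   theorem it is <phi(z) T v, T w> for a bounded operator phi(z).
   The Herglotz kernel of this form is twice the sum over a, b of
   z^a (w^* )^b m_(a - b), with m_0 = A, m_n = M_n and m_(-n) = M_n^*: a limit
   of quadratic forms of Toeplitz matrices. So it is positive on ran T, hence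
   on the whole Hilbert space by density. *)
Require Import Defs.
From HB Require Import structures.
From mathcomp Require Import all_boot all_order all_algebra.
From mathcomp Require Import all_classical all_reals all_analysis.
From mathcomp Require Import sesquilinear complex.
From mathcomp Require Import ring zify.

Set Implicit Arguments.
Unset Strict Implicit.
Unset Printing Implicit Defensive.

Import Order.TTheory GRing.Theory Num.Theory.
Import numFieldNormedType.Exports.

Local Open Scope classical_set_scope.
Local Open Scope ring_scope.

(** * Closed subspaces of Hilbert spaces *)

(** Bundling the closure proofs with the predicate lets the type [csub] below depend on them, so
    that its Hilbert structure can be declared as canonical instances. *)
Record closed_submod (R : realType) (H : hilbertType R) := ClosedSubmod {
  csub_pred : {pred H} ;
  csub_submod : submod_closed csub_pred ;
  csub_closed : closed [set` csub_pred] }.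

Section ClosedSubmod.
Variables (R : realType) (H : hilbertType R) (S : closed_submod H).
Local Notation C := R[i].

Record csub := CSub {
  csub_val : H ;
  _ : csub_val \in csub_pred S }.

HB.instance Definition _ := [isSub for csub_val].
HB.instance Definition _ := [Choice of csub by <:].
HB.instance Definition _ :=
  GRing.isSubmodClosed.Build _ _ (csub_pred S) (csub_submod S).
HB.instance Definition _ := [SubChoice_isSubLmodule of csub by <:].

Lemma csub_val_linear : linear csub_val.
Proof. exact: (linearP (val : csub -> H)). Qed.

HB.instance Definition _ :=
  GRing.isLinear.Build C csub H *:%R csub_val csub_val_linear.

Definition csub_norm (x : csub) : C := `|csub_val x|.

Lemma csub_normD (x y : csub) : csub_norm (x + y) <= csub_norm x + csub_norm y.
Proof. by rewrite /csub_norm raddfD ler_normD. Qed.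

Lemma csub_normZ (a : C) (x : csub) : csub_norm (a *: x) = `|a| * csub_norm x.
Proof. by rewrite /csub_norm linearZ normrZ. Qed.

Lemma csub_norm0_eq0 (x : csub) : csub_norm x = 0 -> x = 0.
Proof. move=> /normr0_eq0 x0; apply/val_inj.
by rewrite -[LHS]/(csub_val x) x0 -(raddf0 csub_val). Qed.

HB.instance Definition _ :=
  Lmodule_isNormed.Build C csub csub_normD csub_normZ csub_norm0_eq0.

Lemma csub_normE (x : csub) : `|x| = `|csub_val x|.
Proof. by []. Qed.

(** The inclusion into [H] is isometric, so a Cauchy filter has a limit in [H], and closedness keeps
    this limit in the subspace. *)
Lemma csub_complete (F : set_system csub) : ProperFilter F -> cauchy F -> cvg F.
Proof.
move=> FF /cauchy_ballP Fc.
have /cauchy_cvgP/cvg_ex[h Fh] : cauchy ((val : csub -> H) @ F).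
  apply/cauchy_ballP => e e0; near_simpl.
  have := Fc _ e0; rewrite near_simpl; apply: filterS => -[x y].
  by rewrite -!ball_normE /= -raddfB.
have Sh : h \in csub_pred S.
  apply: (@closed_cvg _ _ F _ (val : csub -> H)) (@csub_closed _ _ S) _ _ Fh.
  by apply: nearW => x; exact: (valP x).
apply/cvg_ex; exists (CSub Sh); apply/cvgrPdist_lt => e e0.
have /cvgrPdist_lt/(_ _ e0) := Fh.
by apply: filterS => x; rewrite csub_normE raddfB.
Qed.

HB.instance Definition _ := Uniform_isComplete.Build csub csub_complete.

Definition csub_dot (x y : csub) : C := hdot (csub_val x) (csub_val y).

Lemma csub_dot_bilinear :
  bilinear_for ( *%R) (Num.conj \; *%R) csub_dot.
Proof.
by split=> u a x y; rewrite /csub_dot csub_val_linear ?linearPl // linearPr.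
Qed.

HB.instance Definition _ := bilinear_isBilinear.Build _ _ _ _ _ _ csub_dot
  csub_dot_bilinear.

Lemma csub_dot_hermitian x y :
  csub_dot x y = (-1) ^+ false * Num.conj (csub_dot y x).
Proof. exact: hermC. Qed.

HB.instance Definition _ :=
  isHermitianSesquilinear.Build _ _ _ _ csub_dot csub_dot_hermitian.

Lemma csub_dot_gt0 x : x != 0 -> 0 < csub_dot x x.
Proof.
by move=> x0; rewrite /csub_dot dnorm_gt0 -(raddf0 csub_val) (inj_eq val_inj).
Qed.

HB.instance Definition _ := isDotProduct.Build _ _ csub_dot csub_dot_gt0.

Lemma csub_dot_norm (x : csub) : `|x| ^+ 2 = csub_dot x x.
Proof. exact: hdot_norm. Qed.

HB.instance Definition _ := isHilbert.Build R csub csub_dot_norm.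
End ClosedSubmod.

(** * Closure of the range of an operator *)

Section ClosureRange.
Variable R : realType.
Local Notation C := R[i].

Lemma closure_normP (W : normedModType C) (A : set W) (h : W) :
  closure A h <-> forall e : C, 0 < e -> exists2 a, A a & `|h - a| < e.
Proof.
split=> [clh e e0|clh B /nbhs_ballP[e /= e0 eB]].
  by have [a []] := clh _ (nbhsx_ballx h e e0); rewrite -ball_normE; exists a.
have [a Aa ha] := clh e e0; exists a; split=> //.
by apply: eB; rewrite -ball_normE.
Qed.

Lemma dense_normP (W : normedModType C) (A : set W) :
  dense A <-> forall (h : W) (e : C), 0 < e -> exists2 a, A a & `|h - a| < e.
Proof.
split=> [dA h|dA O [h Oh] oO].
  apply/closure_normP => B; rewrite nbhsE => -[U [oU Uh] UB].
  have [a [Ua Aa]] := dA U (ex_intro _ h Uh) oU.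
  by exists a; split=> //; exact: UB.
have /(_ h)/closure_normP clh := dA.
by have [a []] := clh _ (open_nbhs_nbhs (conj oO Oh)); exists a.
Qed.

Variables (V : topologicalLmodType C) (H : hilbertType R) (T : 'L(V, H)).

Definition closure_range_pred : {pred H} := fun h => `[< closure (range T) h >].

Lemma closure_range_submod : submod_closed closure_range_pred.
Proof.
split.
  by apply/asboolP/subset_closure; exists 0 => //; rewrite linear0.
move=> a u v /asboolP/closure_normP clu /asboolP/closure_normP clv.
apply/asboolP/closure_normP => e e0.
(* Dividing by [|a| + 1] rather than by [|a|] covers [a = 0]. *)
have a0 : 0 < `|a| + 1 by rewrite ltr_wpDl.
have [_ [x _ <-] ux] := clu (e / 2 / (`|a| + 1)) ltac:(by rewrite !divr_gt0).
have [_ [y _ <-] vy] := clv (e / 2) ltac:(by rewrite divr_gt0).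
exists (T (a *: x + y)); first by exists (a *: x + y).
rewrite linearP opprD addrACA -scalerBr (le_lt_trans (ler_normD _ _))//.
rewrite [ltRHS]splitr ler_ltD// normrZ.
rewrite (@le_trans _ _ ((`|a| + 1) * `|u - T x|)) ?ler_wpM2r ?lerDl//.
by rewrite mulrC -ler_pdivlMr// ltW.
Qed.

Lemma closure_range_closed : closed [set` closure_range_pred].
Proof.
rewrite (_ : [set` _] = closure (range T)); first exact: closed_closure.
by apply/seteqP; split=> x /asboolP.
Qed.

Definition closure_range : closed_submod H :=
  ClosedSubmod closure_range_submod closure_range_closed.

Lemma corestrict_subproof v : T v \in csub_pred closure_range.
Proof. by apply/asboolP/subset_closure; exists v. Qed.

Lemma corestrict_contlin :
  (fun v => CSub (corestrict_subproof v))
    \in @contlin_pred R V (csub closure_range).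
Proof.
apply/asboolP; split=> [a u v|v].
  by apply/val_inj; rewrite /= linearP.
have Tv := @contlin_continuous _ _ _ T v.
apply/cvgrPdist_lt => e e0; move/cvgrPdist_lt : Tv => /(_ _ e0).
by apply: filterS => x; rewrite csub_normE raddfB.
Qed.

Definition corestrict : 'L(V, csub closure_range) := ContLin corestrict_contlin.

Lemma corestrict_dense : dense (range corestrict).
Proof.
apply/dense_normP => h e e0.
have /asboolP/closure_normP/(_ _ e0)[_ [v _ <-] hv] := valP h.
by exists (corestrict v); [exists v | rewrite csub_normE raddfB].
Qed.

(** The inner product of the subspace is that of [H], so shrinking the target leaves the form <T v,
    T w> unchanged. *)
Lemma hadj_corestrict : hadj corestrict \oL corestrict = hadj T \oL T.
Proof. by apply/val_inj/funext => v; apply/val_inj. Qed.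

End ClosureRange.

(** * Riesz representation *)

Section Riesz.
Variable R : realType.
Local Notation C := R[i].

(** Positive elements of [C] are real, so the complex-valued radii of normed modules over [C] can be
    traded for real ones. *)
Lemma posc_real (e : C) : 0 < e -> exists2 r : R, 0 < r & e = r%:C%C.
Proof.
move=> e0; exists (complex.Re e).
  by move: e0; rewrite ltcE => /andP[].
by rewrite RRe_real// gtr0_real.
Qed.

Lemma near_harmonic_lt (e : C) : 0 < e -> \forall n \near \oo, n.+1%:R^-1 < e.
Proof.
move=> /posc_real[r r0 ->].
have := near_infty_natSinv_lt (PosNum r0); apply: filterS => n /=.
by rewrite -ltcR /= rmorphV ?unitfE// rmorph_nat.
Qed.

(* A form [a + t^* g + t g^* + |t|^2 b] is minimal at [t = - g / b]. *)
Lemma quad_form_disc (a b g : C) : 0 <= a -> 0 <= b ->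
  (forall t : C, 0 <= a + (t^* * g + t * g^*) + `|t| ^+ 2 * b) ->
  `|g| ^+ 2 <= a * b.
Proof.
move=> a0 b0 q; have [b0'|b0'] := eqVneq b 0.
  have [->|g0] := eqVneq g 0; first by rewrite normr0 expr0n/= mulr_ge0.
  have n0 : 0 < `|g| ^+ 2 by rewrite exprn_gt0// normr_gt0.
  (* For [b = 0] there is no minimizer; this [t] gives the form the value [- a - 2 < 0], which rules
     out [g != 0]. *)
  have := q (- ((a + 1) / `|g| ^+ 2) * g).
  have r : ((a + 1) / `|g| ^+ 2)^* = (a + 1) / `|g| ^+ 2.
    by rewrite conj_Creal// ger0_real// mulr_ge0 ?addr_ge0// invr_ge0 ltW.
  rewrite b0' mulr0 addr0 rmorphM rmorphN/= r !mulNr -!mulrA.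
  rewrite [g^* * g]mulrC -normCK mulVf ?gt_eqF// mulr1.
  rewrite -opprD addrA subr_ge0 -lerBDr.
  move=> h; suff : a - 1 < a + 1 + a by rewrite (le_gtF h).
  by rewrite -addrA ltrD2l (@lt_le_trans _ _ 0) ?ltrN10 ?addr_ge0.
have b1 : 0 < b by rewrite lt_neqAle eq_sym b0'.
have := q (- (g / b)).
have r : (b^-1)^* = b^-1 by rewrite conj_Creal// ger0_real// invr_ge0.
rewrite normrN normrM normfV (ger0_norm b0) rmorphN rmorphM/= r.
rewrite !mulNr mulrAC [g^* * g]mulrC [g / b * _]mulrAC -normCK.
have -> : (`|g| / b) ^+ 2 * b = `|g| ^+ 2 / b.
  by rewrite expr_div_n -mulrA; congr (_ * _); rewrite expr2 invfM mulfVK.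
rewrite addrA subrK subr_ge0 ler_pdivrMr//.
Qed.

(** Nonnegativity in [C] includes being real. The sequence equals the sequence of its norms, so
    uniqueness of limits makes [l] equal to its norm. *)
Lemma limr_ge0 (u : nat -> C^o) (l : C^o) :
  u @ \oo --> l -> (forall n, 0 <= u n) -> 0 <= (l : C).
Proof.
move=> ul u0; have := @cvg_norm _ _ _ _ _ u l ul.
have -> : (fun n => `|u n|) = u by apply/funext => n; rewrite ger0_norm.
move=> ul'.
by rewrite (cvg_unique (@norm_hausdorff _ C^o) ul (ul' _)) normr_ge0.
Qed.

Section Representation.
Variables (V : lmodType C) (H : hilbertType R) (T : {linear V -> H}).
Variables (f : V -> C) (c : C).
Hypothesis flin : linear_for (Num.conj \; *%R) f.
Hypothesis c0 : 0 <= c.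
Hypothesis fT : forall w, `|f w| <= c * `|T w|.

(** If [h] represents [f], then J w = |T w - h|^2 - |h|^2: making [J] small drives [T w] towards
    [h]. *)
Let J w : C := hdot (T w) (T w) - (f w + (f w)^*).

Let J_ge w : - c ^+ 2 <= J w.
Proof.
have : f w + (f w)^* <= c * `|T w| + c * `|T w|.
  apply: (@le_trans _ _ `|f w + (f w)^*|).
    by apply: real_ler_norm; rewrite CrealE rmorphD/= conjCK addrC.
  by rewrite (le_trans (ler_normD _ _))// norm_conjC lerD.
move=> h; rewrite /J -hdot_norm lerNl opprB lerBlDr.
apply: (le_trans h); rewrite -mulr2n addrC -subr_ge0 mulrC addrAC -sqrrB.
by rewrite real_exprn_even_ge0// rpredB// ger0_real.
Qed.

Let J_real w : (complex.Re (J w))%:C%C = J w.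
Proof.
rewrite RRe_real// /J -hdot_norm rpredB//; first by rewrite rpredX// normr_real.
by rewrite CrealE rmorphD/= conjCK addrC.
Qed.

Let J_quad u x (t : C) (g := hdot (T u) (T x) - f x) :
  J (u + t *: x) = J u + (t^* * g + t * g^*) + `|t| ^+ 2 * `|T x| ^+ 2.
Proof.
rewrite /J linearD linearZ dnormD dnormZ /g.
have -> : f (u + t *: x) = f u + t^* * f x.
  by rewrite addrC flin/= addrC.
rewrite linearZr_LR/= !rmorphD !rmorphN !rmorphM/= conjCK.
by rewrite !hdot_norm; ring.
Qed.

(* [u] is an approximate minimizer of |T w|^2 - 2 Re (f w). *)
Lemma riesz_approx (d : C) : 0 < d ->
  exists u, forall x, `|hdot (T u) (T x) - f x| <= d * `|T x|.
Proof.
move=> /posc_real[e e0 ->{d}].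
pose E : set R := range (fun w => complex.Re (J w)).
have Einf : has_inf E.
  split; first by exists (complex.Re (J 0)); exists 0.
  exists (complex.Re (- c ^+ 2)) => _ [w _ <-].
  by move: (J_ge w); rewrite lecE => /andP[].
(* The slack is [e ^+ 2] because it becomes the constant term [a] of [quad_form_disc], which bounds
   the square of the residual. *)
have [_ [u _ <-] Ju] := inf_adherent (exprn_gt0 2 e0) Einf.
have e0' := ltW e0.
exists u => x; rewrite -(@ler_pXn2r _ 2) ?nnegrE ?mulr_ge0// ?ler0c//.
rewrite exprMn; apply: quad_form_disc => [||t]; rewrite ?exprn_ge0 ?ler0c//.
have : inf E <= complex.Re (J (u + t *: x)).
  by apply: ge_inf => //; [exact: Einf.2|exists (u + t *: x)].
rewrite -(lerD2r (e ^+ 2)) => /(lt_le_trans Ju)/ltW.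
rewrite -lecR rmorphD rmorphXn/= !J_real J_quad -subr_ge0.
set g := _ - f x => h; have -> : e%:C%C ^+ 2 + (t^* * g + t * g^*) +
    `|t| ^+ 2 * `|T x| ^+ 2 = J u + (t^* * g + t * g^*) +
    `|t| ^+ 2 * `|T x| ^+ 2 + e%:C%C ^+ 2 - J u by ring.
exact: h.
Qed.

(** The approximate minimizers [u k], with residual factor 1/(k+1), have Cauchy images under [T];
    the limit of these images is the representing vector. *)
Lemma riesz_range : exists h : H, (forall x, hdot h (T x) = f x) /\ `|h| <= c.
Proof.
have d0 k : 0 < k.+1%:R^-1 :> C by rewrite invr_gt0.
have [u uP] := choice (fun k => riesz_approx (d0 k)).
have uc k l : `|T (u k) - T (u l)| <= k.+1%:R^-1 + l.+1%:R^-1.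
  have [->|n0] := eqVneq (T (u k) - T (u l)) 0.
    by rewrite normr0 addr_ge0// ltW.
  rewrite -(@ler_pM2r _ `|T (u k) - T (u l)|) ?normr_gt0// -expr2 hdot_norm.
  rewrite -[X in hdot _ X]linearB -[leLHS]ger0_norm ?dnorm_ge0//; last first.
    by rewrite linearB dnorm_ge0.
  rewrite -[T (u k) - _]linearB.
  set x := u k - u l.
  (* Subtracting the two approximate identities at the test vector [u k - u l] cancels [f], and each
     residual keeps a factor [|T x|] that can be divided out. *)
  have -> : hdot (T x) (T x) =
      (hdot (T (u k)) (T x) - f x) - (hdot (T (u l)) (T x) - f x).
    by rewrite {1}/x linearB linearBl/= opprB addrA subrK.
  by rewrite (le_trans (ler_normB _ _))// mulrDl lerD ?uP.
have /cauchy_cvgP/cvg_ex[h uh] : cauchy ((fun k => T (u k)) @ \oo).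
  apply/cauchy_exP => e e0.
  have e20 : 0 < e / 2 by rewrite divr_gt0.
  have [N _ NP] := near_harmonic_lt e20.
  exists (T (u N)), N => // k Nk; rewrite -ball_normE /=.
  by rewrite (le_lt_trans (uc _ _))// [ltRHS]splitr ltrD// NP/=.
have hT x : hdot h (T x) = f x.
  have u1 : (fun k => hdot (T (u k)) (T x) : C^o) @ \oo -->
      (hdot h (T x) : C^o).
    exact: (cvg_comp _ _ uh (@hdot_continuousl _ _ (T x) h)).
  have u2 : (fun k => hdot (T (u k)) (T x) : C^o) @ \oo --> (f x : C^o).
    apply/cvgrPdist_lt => e e0.
    have n1 : 0 < `|T x| + 1 by rewrite ltr_wpDl.
    have := near_harmonic_lt (divr_gt0 e0 n1); apply: filterS => k kP.
    rewrite distrC (le_lt_trans (uP k x))//.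
    rewrite (@le_lt_trans _ _ (k.+1%:R^-1 * (`|T x| + 1)))//.
      by rewrite ler_wpM2l ?lerDl// ltW.
    by rewrite -ltr_pdivlMr.
  exact: (cvg_unique (@norm_hausdorff _ C^o) u1 u2).
exists h; split=> //.
have [->|h0] := eqVneq h 0; first by rewrite normr0.
rewrite -(@ler_pM2r _ `|h|) ?normr_gt0// -subr_ge0.
(* The bound on [f] at [u k] tends to |h|^2 <= c |h|, from which one factor |h| cancels. *)
have u1 : (fun k => c * `|T (u k)| - `|hdot h (T (u k))| : C^o) @ \oo -->
    (c * `|h| - `|hdot h h| : C^o).
  have n1 : (fun k => `|hdot h (T (u k))| : C^o) @ \oo --> (`|hdot h h| : C^o).
    apply: (@cvg_norm _ C^o).
    exact: (cvg_comp _ _ uh (@hdot_continuousr _ _ h h)).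
  have n2 : (fun k => `|T (u k)| : C^o) @ \oo --> (`|h| : C^o).
    exact: cvg_norm uh.
  exact: (@cvgB _ C^o _ _ _ _ _ _ _ (@cvgMl_tmp _ _ _ _ _ c _ n2) n1).
have -> : `|h| * `|h| = `|hdot h h|.
  by rewrite -expr2 hdot_norm ger0_norm ?dnorm_ge0.
apply: limr_ge0 u1 _ => k; rewrite subr_ge0 hT; exact: fT.
Qed.

End Representation.
End Riesz.

(** * Bounded sesquilinear forms over a dense range *)

Section FormRepresentation.
Variable R : realType.
Local Notation C := R[i].

Section DenseRange.
Variables (V : lmodType C) (H : hilbertType R) (T : {linear V -> H}).
Hypothesis dT : dense (range T).

(** The difference z = x - y is orthogonal to the range, so |z|^2 = <z, z - T v> <= e |z| as soon as
    [T v] is within [e] of z. *)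
Lemma dense_hdot_inj (x y : H) :
  (forall v, hdot x (T v) = hdot y (T v)) -> x = y.
Proof.
move=> xy; apply/eqP; rewrite -subr_eq0 -normr_le0.
have z0 v : hdot (x - y) (T v) = 0 by rewrite linearBl/= xy subrr.
apply/ler_addgt0Pr => e e0; rewrite add0r.
have [->|n0] := eqVneq (x - y) 0; first by rewrite normr0 ltW.
rewrite -(@ler_pM2r _ `|x - y|) ?normr_gt0// -expr2 hdot_norm.
have /dense_normP/(_ (x - y) _ e0)[_ [v _ <-] ve] := dT.
rewrite -[hdot _ _]subr0 -[in X in _ - X](z0 v) -linearB.
rewrite (le_trans (real_ler_norm _))//.
  by rewrite linearB/= z0 subr0 ger0_real// dnorm_ge0.
by rewrite (le_trans (hdot_CauchySchwarz _ _))// mulrC ler_wpM2r// ltW.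
Qed.

(** The Riesz theorem is applied twice. For fixed [w] it gives [n w], which plays the role of the
    adjoint of [m] at [T w]; for fixed [h] it represents w |-> <h, n w> by [m h]. Thus [m] is
    defined on all of [H] without extension by continuity. *)
Lemma form_representation (B : V -> V -> C) (c : C) :
  0 <= c -> bilinear_for ( *%R) (Num.conj \; *%R) B ->
  (forall v w, `|B v w| <= c * `|T v| * `|T w|) ->
  exists m : 'L(H, H), forall v w, hdot (m (T v)) (T w) = B v w.
Proof.
move=> c0 [Bl Br] Bc.
have ex_n w : exists n, (forall v, hdot n (T v) = (B v w)^*) /\
    `|n| <= c * `|T w|.
  apply: riesz_range => [a u v||v]; last by rewrite norm_conjC mulrAC.
    by rewrite Bl rmorphD rmorphM.
  exact: mulr_ge0.
have [n nP] := choice ex_n.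
have n_linear a u v : n (a *: u + v) = a *: n u + n v.
  apply: dense_hdot_inj => w.
  by rewrite linearPl/= !(nP _).1 Br rmorphD rmorphM/= conjCK.
have ex_m h : exists m, (forall w, hdot m (T w) = hdot h (n w)) /\
    `|m| <= c * `|h|.
  apply: riesz_range => [a u v||w]; first by rewrite n_linear linearPr.
    exact: mulr_ge0.
  rewrite (le_trans (hdot_CauchySchwarz _ _))// mulrC mulrAC ler_wpM2r//.
  exact: (nP w).2.
have [m mP] := choice ex_m.
have m_linear : linear m.
  move=> a u v; apply: dense_hdot_inj => w.
  by rewrite linearPl/= !(mP _).1 linearPl.
pose mL : {linear H -> H} :=
  HB.pack m (GRing.isLinear.Build _ _ _ _ m m_linear).
have m_cont : continuous m.
  apply: (@bounded_linear_continuous _ _ _ mL); apply/linear_boundedP.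
  exists c; split; first exact: ger0_real.
  by move=> r cr x; rewrite (le_trans (mP x).2)// ler_wpM2r// ltW.
have mL' : m \in @contlin_pred R H H by apply/asboolP.
exists (ContLin mL') => v w /=.
rewrite (mP _).1 hermC expr0 mul1r -[RHS]conjCK; congr (Num.conj _).
exact: (nP w).1.
Qed.

End DenseRange.
End FormRepresentation.

(** * Complex sequences and series *)

Section ComplexSequences.
Variable R : realType.
Local Notation C := R[i].

Lemma cvg_real_complex (u : nat -> R) (l : R) : u @ \oo --> l ->
  (fun n => (u n)%:C%C : C^o) @ \oo --> (l%:C%C : C^o).
Proof.
move=> /cvgrPdist_lt ul; apply/(@cvgrPdist_lt _ C^o) => e /posc_real[r r0 ->].
have := ul r r0; apply: filterS => n; rewrite -rmorphB/= normc_def/= expr0n/=.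
by rewrite addr0 sqrtr_sqr ltcR.
Qed.

Lemma near_expr_lt (z e : C) : `|z| < 1 -> 0 < e ->
  \forall n \near \oo, `|z| ^+ n < e.
Proof.
move=> z1 /posc_real[r r0 ->]; have zE : `|z| = (complex.Re `|z|)%:C%C.
  by rewrite RRe_real// normr_real.
have z1' : `|complex.Re `|z| | < 1.
  by rewrite -ltcR; apply: le_lt_trans z1; rewrite -[leRHS]normr_id normc_ge_Re.
have /cvgrPdist_lt/(_ _ r0) := cvg_expr z1'.
apply: filterS => n; rewrite sub0r normrN normrX => h.
rewrite zE -rmorphXn/= ltcR.
by rewrite (le_lt_trans _ h)// -normrX ler_norm.
Qed.

(** The limit is the fixed point m = l + q m. The error obeys a contraction of ratio [q] with
    forcing [p n - l]; once the forcing is below (e/2)(1 - |q|), it contributes at most e/2 in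
    total. *)
Lemma affine_recursion_cvg (p x : nat -> C^o) (q l : C) : `|q| < 1 ->
  p @ \oo --> (l : C^o) -> (forall n, x n.+1 = p n + q * x n) ->
  x @ \oo --> (l / (1 - q) : C^o).
Proof.
move=> q1 pl xS; set m := l / (1 - q).
have q0 : 1 - q != 0.
  by rewrite subr_eq0; apply: contraTneq q1 => <-; rewrite normr1 ltxx.
have mE : m = l + q * m.
  by apply/eqP; rewrite -subr_eq -[X in X - _]mul1r -mulrBl mulrC mulfVK.
have eS n : x n.+1 - m = (p n - l) + q * (x n - m).
  by rewrite xS [in LHS]mE mulrBr opprD addrACA.
apply/(@cvgrPdist_lt _ C^o) => e e0.
have e20 : 0 < e / 2 by rewrite divr_gt0.
have q10 : 0 < 1 - `|q| by rewrite subr_gt0.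
have /(@cvgrPdist_lt _ C^o)/(_ _ (mulr_gt0 e20 q10))[N _ NP] := pl.
have bnd k : `|x (N + k)%N - m| <= e / 2 + `|q| ^+ k * `|x N - m|.
  elim: k => [|k IH]; first by rewrite addn0 expr0 mul1r lerDr ltW.
  rewrite addnS eS (le_trans (ler_normD _ _))// normrM exprS -mulrA.
  have h1 : `|p (N + k)%N - l| <= e / 2 * (1 - `|q|).
    by rewrite distrC ltW// NP//= leq_addr.
  have h2 := ler_wpM2l (normr_ge0 q) IH.
  rewrite (le_trans (lerD h1 h2))// [`|q| * (_ + _)]mulrDr addrA lerD2r.
  by rewrite mulrBr mulr1 [`|q| * _]mulrC subrK.
have E0 : 0 < `|x N - m| + 1 by rewrite ltr_wpDl.
have [K _ KP] := near_expr_lt q1 (divr_gt0 e20 E0).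
exists (N + K)%N => //= n NKn.
have Nn : (N <= n)%N := leq_trans (leq_addr _ _) NKn.
rewrite distrC -(subnKC Nn) (le_lt_trans (bnd _))// [ltRHS]splitr ltrD2l.
have := KP (n - N)%N; rewrite /= leq_subRL// => /(_ NKn).
rewrite ltr_pdivlMr//; apply: le_lt_trans.
by rewrite ler_wpM2l ?exprn_ge0// lerDl.
Qed.

Section PowerSeries.
Variables (z c : C) (g : nat -> C).
Hypotheses (z1 : `|z| < 1) (gc : forall n, `|g n| <= c).

Let is_cvg_Re (h : nat -> C) : (forall n, `|h n| <= c) ->
  cvgn (series (fun n => complex.Re (z ^+ n * h n))).
Proof.
move=> hc; have c0 : 0 <= c := le_trans (normr_ge0 _) (hc 0).
have zR : (complex.Re `|z|)%:C%C = `|z| by rewrite RRe_real ?normr_real.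
have cR : (complex.Re c)%:C%C = c by rewrite RRe_real ?ger0_real.
have z0 : 0 <= complex.Re `|z| by rewrite -ler0c zR normr_ge0.
have cR0 : 0 <= complex.Re c by rewrite -ler0c cR.
apply: normed_cvg.
apply: (@series_le_cvg _ _ (geometric (complex.Re c) (complex.Re `|z|))).
- by move=> n; exact: normr_ge0.
- by move=> n; rewrite /= mulr_ge0// exprn_ge0.
- move=> n /=.
  have : `|complex.Re (z ^+ n * h n)|%:C%C <=
      (complex.Re c * complex.Re `|z| ^+ n)%:C%C.
    rewrite (le_trans (normc_ge_Re _))// rmorphM rmorphXn/= zR cR.
    by rewrite normrM normrX mulrC ler_wpM2r ?exprn_ge0.
  by rewrite lecR.
- apply: is_cvg_geometric_series.
  by rewrite ger0_norm// -ltcR zR.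
Qed.

(** Real parts are dominated by a geometric series. Since Im x = - Re (i x), the same result for the
    coefficients [g n * 'i] handles imaginary parts. The bound holds for every partial sum and
    passes to the limit. *)
Lemma power_series_cvg : exists2 l : C,
  (fun k => \sum_(0 <= n < k) z ^+ n * g n : C^o) @ \oo --> (l : C^o) &
  `|l| <= c / (1 - `|z|).
Proof.
have c0 : 0 <= c := le_trans (normr_ge0 _) (gc 0).
have gi n : `|g n * 'i%C| <= c.
  suff i1 : `|'i%C : C| = 1 by rewrite normrM i1 mulr1.
  by rewrite normc_def/= expr0n expr1n/= add0r sqrtr1.
have /cvg_ex[a /cvg_real_complex Ra] := is_cvg_Re gc.
have /cvg_ex[b /cvg_real_complex Ib] := is_cvg_Re gi.
set s := fun k => \sum_(0 <= n < k) z ^+ n * g n : C^o.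
have sl : s @ \oo --> (a%:C%C + - 'i%C * b%:C%C : C^o).
  have -> : s = fun k => (series (fun n => complex.Re (z ^+ n * g n)) k)%:C%C +
      - 'i%C * (series (fun n => complex.Re (z ^+ n * (g n * 'i%C))) k)%:C%C.
    apply/funext => k; rewrite /series/= !rmorph_sum/= mulr_sumr -big_split/=.
    apply: eq_bigr => n _; rewrite mulrA [in X in - 'i%C * X]ReiNIm.
    by rewrite rmorphN mulrNN -complexE.
  exact: (@cvgD _ C^o _ _ _ _ _ _ _ Ra
    (@cvgMl_tmp _ _ _ _ _ _ _ Ib)).
exists (a%:C%C + - 'i%C * b%:C%C) => //.
rewrite -subr_ge0.
have ns : (fun k => c / (1 - `|z|) - `|s k| : C^o) @ \oo -->
    (c / (1 - `|z|) - `|a%:C%C + - 'i%C * b%:C%C| : C^o).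
  have n1 : (fun k => `|s k| : C^o) @ \oo -->
      (`|a%:C%C + - 'i%C * b%:C%C| : C^o).
    exact: (@cvg_norm _ C^o _ _ _ _ _ sl).
  exact: (@cvgB _ C^o _ _ _ _ _ _ _ (cvg_cst _) n1).
apply: limr_ge0 ns _ => k; rewrite subr_ge0.
have z10 : 0 < 1 - `|z| by rewrite subr_gt0.
rewrite ler_pdivlMr//.
apply: (@le_trans _ _ (\sum_(0 <= n < k) `|z| ^+ n * c * (1 - `|z|))).
  rewrite -mulr_suml ler_wpM2r ?(ltW z10)//.
  rewrite (le_trans (ler_norm_sum _ _ _))//; apply: ler_sum => n _.
  by rewrite normrM normrX ler_wpM2l ?exprn_ge0.
under eq_bigr do rewrite mulrAC.
rewrite -mulr_suml mulrC -[leRHS]mulr1 ler_wpM2l//.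
suff -> : \sum_(0 <= n < k) `|z| ^+ n * (1 - `|z|) = 1 - `|z| ^+ k.
  by rewrite lerBlDr lerDl exprn_ge0.
elim: k => [|k IH]; first by rewrite big_geq// expr0 subrr.
by rewrite big_nat_recr//= IH exprS; ring.
Qed.
End PowerSeries.
End ComplexSequences.

(** * Toeplitz forms *)

Section AntidualTheory.
Variable R : realType.
Local Notation C := R[i].
Variable V : topologicalLmodType C.

Lemma contlin_evalD (W X : topologicalLmodType C) (F G : 'L(W, X)) v :
  (F + G) v = F v + G v.
Proof. by []. Qed.

Lemma contlin_evalN (W X : topologicalLmodType C) (F : 'L(W, X)) v :
  (- F) v = - F v.
Proof. by []. Qed.

Lemma contlin_evalZ (W X : topologicalLmodType C) (a : C) (F : 'L(W, X)) v :
  (a *: F) v = a *: F v.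
Proof. by []. Qed.

Lemma contlin_eval0 (W X : topologicalLmodType C) v : (0 : 'L(W, X)) v = 0.
Proof. by []. Qed.

Lemma contlin_antidual_ext (F G : 'L(V, antidual V)) :
  (forall v w, F v w = G v w) -> F = G.
Proof.
by move=> FG; apply/val_inj/funext => v; apply/val_inj/funext => w; exact: FG.
Qed.

Lemma antidual_evalN (f : antidual V) v : (- f) v = - f v.
Proof. by []. Qed.

Lemma antidual_evalD (f g : antidual V) v : (f + g) v = f v + g v.
Proof. by []. Qed.

Lemma antidual_evalZ (a : C) (f : antidual V) v : (a *: f) v = a * f v.
Proof. by []. Qed.

Lemma antidual_eval_suml I (r : seq I) (P : pred I) (F : I -> antidual V) v :
  (\sum_(i <- r | P i) F i) v = \sum_(i <- r | P i) F i v.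
Proof. exact: (big_morph (fun f : antidual V => f v)). Qed.

Lemma antidual_eval0 (f : antidual V) : f 0 = 0.
Proof.
have := antidual_evalE f 1 0 0; rewrite scale1r addr0 conjC1 mul1r => /eqP.
by rewrite eq_sym addrC -subr_eq0 addrK => /eqP.
Qed.

Lemma antidual_evalDr (f : antidual V) u v : f (u + v) = f u + f v.
Proof. by have := antidual_evalE f 1 u v; rewrite scale1r conjC1 mul1r. Qed.

Lemma antidual_evalZr (f : antidual V) a v : f (a *: v) = a^* * f v.
Proof.
by have := antidual_evalE f a v 0; rewrite !addr0 antidual_eval0 addr0.
Qed.

Lemma antidual_eval_sumr (f : antidual V) I (r : seq I) (P : pred I)
    (F : I -> V) :
  f (\sum_(i <- r | P i) F i) = \sum_(i <- r | P i) f (F i).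
Proof.
apply: (big_morph (antidual_eval f)); first exact: antidual_evalDr.
exact: antidual_eval0.
Qed.
End AntidualTheory.

Section Toeplitz.
Variable R : realType.
Local Notation C := R[i].
Variables (V : topologicalLmodType C) (M : nat -> 'L(V, antidual V)).

(** The entries of [toeplitz] with natural number indices, which can be shifted and reversed
    independently of the size of the matrix. *)
Definition toeplitz_entry (i j : nat) : 'L(V, antidual V) :=
  if (i < j)%N then M (j - i)%N
  else if (j < i)%N then dual_adj (M (i - j)%N)
  else 2^-1 *: (M 0%N + dual_adj (M 0%N)).

Lemma toeplitz_entryS i j : toeplitz_entry i.+1 j.+1 = toeplitz_entry i j.
Proof. by rewrite /toeplitz_entry !ltnS !subSS. Qed.

Lemma toeplitz_entry_rev N i j : (i <= N)%N -> (j <= N)%N ->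
  toeplitz_entry (N - i) (N - j) = toeplitz_entry j i.
Proof.
move=> iN jN; have E a b : (a <= N)%N -> (N - a < N - b)%N = (b < a)%N.
  by move=> aN; lia.
have F a b : (a <= N)%N -> (b <= N)%N -> (N - b - (N - a) = a - b)%N.
  by move=> aN bN; lia.
by rewrite /toeplitz_entry !E// !F.
Qed.

Hypothesis M_pos : forall N, block_positive (toeplitz M N).

(* Reversing the order of the indices turns the entry [M_(j - i)] of the
   Toeplitz matrix into [M_(i - j)], the coefficient of [z^i (w^* )^j] in the
   expansion of the Herglotz kernel. *)
Lemma toeplitz_form_ge0 n (u : nat -> V) :
  0 <= \sum_(a < n) \sum_(b < n) toeplitz_entry b a (u b) (u a).
Proof.
case: n => [|N]; first by rewrite big_ord0.
have := M_pos (fun i : 'I_N.+1 => u (rev_ord i)).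
rewrite (reindex_inj rev_ord_inj); congr (0 <= _).
apply: eq_bigr => i _; rewrite /block_op antidual_eval_suml.
rewrite (reindex_inj rev_ord_inj); apply: eq_bigr => j _.
rewrite !rev_ordK mxE -(@toeplitz_entry_rev N)// ?leq_ord//.
Qed.

Let A : 'L(V, antidual V) := 2^-1 *: (M 0%N + dual_adj (M 0%N)).

Lemma toeplitz_coef_bound (H : hilbertType R) (T : 'L(V, H)) n v w :
  A = hadj T \oL T -> `|M n.+1 v w| <= `|T v| * `|T w|.
Proof.
move=> AT; have AE x y : A x y = hdot (T x) (T y) by rewrite AT.
rewrite -(@ler_pXn2r _ 2) ?nnegrE ?mulr_ge0// exprMn.
apply: quad_form_disc => [||t]; rewrite ?exprn_ge0//.
have ends (F : nat -> C) : (forall k, (0 < k < n.+1)%N -> F k = 0) ->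
    \sum_(a < n.+2) F a = F 0%N + F n.+1.
  move=> F0; rewrite big_ord_recl big_ord_recr/= big1 ?add0r// => i _.
  by rewrite F0 ?lift0//= ltnS ltn_ord.
(* Only the two end slots are filled, which isolates the minor with off-diagonal entry [M n.+1]; the
   free scalar [t] yields the form of [quad_form_disc]. *)
pose u k := if k == 0%N then v else if k == n.+1 then t *: w else 0.
have u0 k : (0 < k < n.+1)%N -> u k = 0.
  by case: k => [//|k] /andP[_ kn]; rewrite /u/= eqSS ltn_eqF.
have := toeplitz_form_ge0 n.+2 u.
rewrite (ends (fun a => \sum_(b < n.+2) toeplitz_entry b a (u b) (u a)));
  last first.
  by move=> k kn; rewrite u0// big1// => i _; rewrite antidual_eval0.
rewrite (ends (fun b => toeplitz_entry b 0 (u b) (u 0%N))); last first.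
  by move=> k kn; rewrite u0// linear0.
rewrite (ends (fun b => toeplitz_entry b n.+1 (u b) (u n.+1))); last first.
  by move=> k kn; rewrite u0// linear0.
have E00 : toeplitz_entry 0 0 = A by [].
have Enn : toeplitz_entry n.+1 n.+1 = A by rewrite /toeplitz_entry ltnn.
have E0n : toeplitz_entry 0 n.+1 = M n.+1 by rewrite /toeplitz_entry subn0.
have En0 : toeplitz_entry n.+1 0 = dual_adj (M n.+1).
  by rewrite /toeplitz_entry subn0.
have un : u n.+1 = t *: w by rewrite /u/= eqxx.
rewrite E00 Enn E0n En0 !AE (_ : u 0%N = v)// un.
have Tt : T (t *: w) = t *: T w by rewrite linearZ.
rewrite Tt -!hdot_norm normrZ exprMn dual_adjE !antidual_evalZr.
rewrite rmorphM/= conjCK.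
by rewrite !addrA [_ + t * _ + _]addrAC.
Qed.

(** Entries depend only on the difference of the indices, so the terms with both indices positive
    reproduce [X n] with a factor z conj(w); the first row and column give [A] and the partial sums.
    Iterating this recursion produces the factor 1/(1 - z conj(w)) of the Herglotz kernel. *)
Lemma toeplitz_form_rec n (z w : C) v y
  (X := fun n => \sum_(a < n) \sum_(b < n)
     z ^+ a * w^* ^+ b * toeplitz_entry b a v y)
  (S := fun z v y => \sum_(1 <= k < n.+1) z ^+ k * M k v y) :
  X n.+1 = A v y + S z v y + (S w y v)^* + z * w^* * X n.
Proof.
have E0S k : toeplitz_entry 0 k.+1 = M k.+1 by rewrite /toeplitz_entry subn0.
have ES0 k : toeplitz_entry k.+1 0 = dual_adj (M k.+1).
  by rewrite /toeplitz_entry subn0.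
rewrite {1}/X big_ord_recl.
have -> : \sum_(b < n.+1) z ^+ (ord0 : 'I_n.+1) * w^* ^+ b *
    toeplitz_entry b (ord0 : 'I_n.+1) v y = A v y + (S w y v)^*.
  rewrite big_ord_recl !expr0 !mul1r; congr (_ + _).
  rewrite /S big_add1 big_mkord rmorph_sum; apply: eq_bigr => i _.
  by rewrite lift0 mul1r ES0 dual_adjE rmorphM rmorphXn.
rewrite -!addrA; congr (_ + _); rewrite [RHS]addrCA; congr (_ + _).
rewrite /S big_add1 big_mkord /X mulr_sumr -big_split; apply: eq_bigr => a _.
rewrite lift0 big_ord_recl expr0 mulr1 E0S; congr (_ + _).
rewrite mulr_sumr; apply: eq_bigr => b _.
by rewrite lift0 toeplitz_entryS !exprS; ring.
Qed.

End Toeplitz.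

(** * Herglotz kernels *)

Section Herglotz.
Variable R : realType.
Local Notation C := R[i].

Lemma hadj_compE (V : topologicalLmodType C) (H : hilbertType R)
    (T : 'L(V, H)) (F : 'L(H, H)) v w :
  (hadj T \oL F \oL T) v w = hdot (F (T v)) (T w).
Proof. by []. Qed.

Lemma hdotPl (H : hilbertType R) (a : C) (x y z : H) :
  hdot (a *: x + y) z = a * hdot x z + hdot y z.
Proof. exact: linearPl. Qed.

Lemma hdotPr (H : hilbertType R) (a : C) (x y z : H) :
  hdot z (a *: x + y) = a^* * hdot z x + hdot z y.
Proof. exact: linearPr. Qed.

Lemma riesz_compE (H : hilbertType R) (F : 'L(H, H)) x y :
  (riesz H \oL F) x y = hdot (F x) y.
Proof. by []. Qed.

Lemma herglotz_kernelE (V : topologicalLmodType C)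
    (Phi : C -> 'L(V, antidual V)) (z w : C) (v y : V) :
  herglotz_kernel Phi z w v y =
  (1 - z * w^*)^-1 * (Phi z v y + (Phi w y v)^*).
Proof. by []. Qed.

(** The scalars in the definition of a positive semidefinite matrix are absorbed by replacing each
    [v i] with [c i 0 *: v i]. *)
Lemma caratheodory_herglotzP (V : topologicalLmodType C)
    (Phi : C -> 'L(V, antidual V)) :
  caratheodory_herglotz Phi <->
  forall n (z : 'I_n -> C) (v : 'I_n -> V), (forall i, unit_disk (z i)) ->
    0 <= \sum_(l < n) \sum_(j < n) (1 - z l * (z j)^*)^-1 *
           (Phi (z l) (v j) (v l) + (Phi (z j) (v l) (v j))^*).
Proof.
split=> [K n z v zD|P n z v zD c].
  have := K n z v zD (\col__ 1); congr (0 <= _).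
  apply: eq_bigr => l _; apply: eq_bigr => j _.
  by rewrite !mxE conjC1 mul1r mulr1 herglotz_kernelE.
have := P n z (fun i => c i 0 *: v i) zD; congr (0 <= _).
apply: eq_bigr => l _; apply: eq_bigr => j _.
rewrite mxE herglotz_kernelE !linearZ !antidual_evalZ !antidual_evalZr.
by rewrite !rmorphM/= conjCK; ring.
Qed.

(** The contribution of [D] to the kernel is [D + dual_adj D = 0]; what remains is the kernel of
    [phi] at the vectors [T (v i)]. *)
Lemma caratheodory_herglotz_comp (V : topologicalLmodType C) (H : hilbertType R)
    (D : 'L(V, antidual V)) (T : 'L(V, H)) (phi : C -> 'L(H, H))
    (Phi : C -> 'L(V, antidual V)) :
  purely_imaginary D -> caratheodory_herglotz_hilbert phi ->
  (forall z, unit_disk z -> Phi z = D + hadj T \oL phi z \oL T) ->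
  caratheodory_herglotz Phi.
Proof.
move=> D0 /caratheodory_herglotzP phiP PhiE.
apply/caratheodory_herglotzP => n z v zD.
have := phiP n z (fun i => T (v i)) zD; congr (0 <= _).
apply: eq_bigr => l _; apply: eq_bigr => j _; congr (_ * _).
rewrite !PhiE//.
have DD x y : D x y + (D y x)^* = 0.
  by rewrite -dual_adjE -antidual_evalD -contlin_evalD D0.
rewrite !contlin_evalD !antidual_evalD !hadj_compE !riesz_compE.
by rewrite rmorphD addrACA DD add0r.
Qed.

Lemma cvg_hdot (H : hilbertType R) (a b : nat -> H) (x y : H) :
  a @ \oo --> x -> b @ \oo --> y ->
  (fun k => hdot (a k) (b k) : C^o) @ \oo --> (hdot x y : C^o).
Proof.
move=> ax bY.
have c1 : (fun k => hdot (a k) y : C^o) @ \oo --> (hdot x y : C^o).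
  exact: (cvg_comp _ _ ax (@hdot_continuousl _ _ y x)).
have c2 : (fun k => hdot (a k) (b k - y) : C^o) @ \oo --> (0 : C^o).
  apply/(@cvgrPdist_lt _ C^o) => e e0.
  have x1 : 0 < `|x| + 1 by rewrite ltr_wpDl.
  have /cvgrPdist_lt/(_ _ ltr01) ax1 := ax.
  have /cvgrPdist_lt/(_ _ (divr_gt0 e0 x1)) by1 := bY.
  near=> k; rewrite sub0r normrN (le_lt_trans (hdot_CauchySchwarz _ _))//.
  have ak : `|a k| <= `|x| + 1.
    rewrite -[a k](subrK x) addrC (le_trans (ler_normD _ _))// lerD2l distrC.
    by rewrite ltW//; near: k.
  apply: (@le_lt_trans _ _ ((`|x| + 1) * `|b k - y|)); first exact: ler_wpM2r.
  by rewrite mulrC -ltr_pdivlMr// distrC; near: k.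
have -> : (fun k => hdot (a k) (b k)) =
    (fun k => hdot (a k) y + hdot (a k) (b k - y)).
  by apply/funext => k; rewrite linearB/= addrC subrK.
have c3 := @cvgD _ C^o _ _ _ _ _ _ _ c1 c2.
rewrite addr0 in c3; exact: c3.
Unshelve. all: by end_near. Qed.

Lemma dense_seq (W : normedModType C) (A : set W) (x : W) : dense A ->
  exists2 a : nat -> W, (forall k, A (a k)) & a @ \oo --> x.
Proof.
move=> /dense_normP dA.
have d0 k : 0 < k.+1%:R^-1 :> C by rewrite invr_gt0.
have ex_a k : exists a, A a /\ `|x - a| < k.+1%:R^-1.
  by have [a] := dA x _ (d0 k); exists a.
have [a aP] := choice ex_a.
exists a => [k|]; first exact: (aP k).1.
apply/cvgrPdist_lt => e e0; have := near_harmonic_lt e0.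
by apply: filterS => k; apply: lt_trans (aP k).2.
Qed.

(** For fixed points of the disk the quadratic form is continuous in the vectors, because each
    [phi (z i)] is, so its sign survives limits of vectors of the range. *)
Lemma herglotz_hilbert_dense (V : lmodType C) (H : hilbertType R)
    (T : {linear V -> H}) (phi : C -> 'L(H, H)) : dense (range T) ->
  (forall n (z : 'I_n -> C) (v : 'I_n -> V), (forall i, unit_disk (z i)) ->
    0 <= \sum_(l < n) \sum_(j < n) (1 - z l * (z j)^*)^-1 *
      (hdot (phi (z l) (T (v j))) (T (v l)) +
       (hdot (phi (z j) (T (v l))) (T (v j)))^*)) ->
  caratheodory_herglotz_hilbert phi.
Proof.
move=> dT P; apply/caratheodory_herglotzP => n z x zD.
have ex_a i : exists v : nat -> V, (fun k => T (v k)) @ \oo --> x i.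
  have [a aT ax] := dense_seq (x i) dT.
  have [v vP] := choice (fun k =>
    let: ex_intro2 v _ e := aT k in ex_intro (fun v => T v = a k) v e).
  by exists v; rewrite (funext vP).
have [v vP] := choice ex_a.
apply: (@limr_ge0 _ (fun k => \sum_(l < n) \sum_(j < n) (1 - z l * (z j)^*)^-1 *
      (hdot (phi (z l) (T (v j k))) (T (v l k)) +
       (hdot (phi (z j) (T (v l k))) (T (v j k)))^*))); last first.
  by move=> k; exact: (P n z (fun i => v i k)).
apply: cvg_big => [|l _]; first exact: add_continuous.
apply: cvg_big => [|j _]; first exact: add_continuous.
have c m i i' : (fun k => hdot (phi m (T (v i k))) (T (v i' k)) : C^o) @ \oo -->
    (hdot (phi m (x i)) (x i') : C^o).
  apply: cvg_hdot; last exact: vP.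
  exact: (cvg_comp _ _ (vP i) (@contlin_continuous _ _ _ (phi m) _)).
have cc := cvg_comp _ _ (c (z j) l j) (@conj_continuous _ _).
exact: (@cvgMl_tmp _ _ _ _ _ _ _
  (@cvgD _ C^o _ _ _ _ _ _ _ (c (z l) j l) cc)).
Qed.

End Herglotz.

(** * Positivity of the Herglotz kernel of a Toeplitz series *)

Section ToeplitzSeries.
Variable R : realType.
Local Notation C := R[i].
Variables (V : topologicalLmodType C) (M : nat -> 'L(V, antidual V)).
Hypothesis M_pos : forall N, block_positive (toeplitz M N).

Let A : 'L(V, antidual V) := 2^-1 *: (M 0%N + dual_adj (M 0%N)).

Lemma toeplitz_diag_positive : positive_op A.
Proof.
by move=> v; have := toeplitz_form_ge0 M_pos 1 (fun=> v); rewrite !big_ord1.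
Qed.

Variable L : C -> V -> V -> C.
Hypothesis L_cvg : forall z v w, unit_disk z ->
  (fun k => \sum_(1 <= n < k) z ^+ n * M n v w : C^o) @ \oo --> (L z v w : C^o).

Lemma toeplitz_herglotz_ge0 n (z : 'I_n -> C) (v : 'I_n -> V) :
  (forall i, unit_disk (z i)) ->
  0 <= \sum_(l < n) \sum_(j < n) (1 - z l * (z j)^*)^-1 *
    (A (v j) (v l) + L (z l) (v j) (v l) + (L (z j) (v l) (v j))^*).
Proof.
move=> zD.
(* The expansion of the kernel summand truncated to powers below [N]; its limit comes from the
   recursion of ratio z_l conj(z_j). *)
pose X N l j := \sum_(a < N) \sum_(b < N)
  z l ^+ a * (z j)^* ^+ b * toeplitz_entry M b a (v j) (v l).
apply: (@limr_ge0 _ (fun N => \sum_(l < n) \sum_(j < n) X N l j)).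
  apply: cvg_big => [|l _]; first exact: add_continuous.
  apply: cvg_big => [|j _]; first exact: add_continuous.
  rewrite mulrC.
  pose S k x u w := \sum_(1 <= i < k) x ^+ i * M i u w : C^o.
  apply: (@affine_recursion_cvg _ (fun N => A (v j) (v l) +
      S N.+1 (z l) (v j) (v l) + (S N.+1 (z j) (v l) (v j))^*)).
  - rewrite normrM norm_conjC -[ltRHS]mulr1; apply: ltr_pM => //; exact: zD.
  - have S_cvg x u w : unit_disk x ->
        (fun N => S N.+1 x u w) @ \oo --> (L x u w : C^o).
      move=> xD; have := @L_cvg x u w xD.
      by rewrite -(cvg_shiftS (fun k => S k x u w)).
    have c1 := S_cvg _ (v j) (v l) (zD l).
    have c2 : (fun N => (S N.+1 (z j) (v l) (v j))^* : C^o) @ \oo -->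
        ((L (z j) (v l) (v j))^* : C^o).
      exact: (cvg_comp _ _ (S_cvg _ _ _ (zD j)) (@conj_continuous _ _)).
    have c3 : (fun N =>
          A (v j) (v l) + S N.+1 (z l) (v j) (v l) : C^o) @ \oo -->
        (A (v j) (v l) + L (z l) (v j) (v l) : C^o).
      exact: (@cvgD _ C^o _ _ _ _ _ _ _ (@cvg_cst C^o _ _ _ _) c1).
    exact: (@cvgD _ C^o _ _ _ _ _ _ _ c3 c2).
  - by move=> N; exact: toeplitz_form_rec.
(* The Toeplitz form is evaluated at u_b = sum_j conj(z_j)^b v_j; antilinearity in the second slot
   turns conj(z_l)^a into z_l^a, and exchanging sums recovers [X]. *)
move=> N; have := toeplitz_form_ge0 M_pos N
  (fun b => \sum_(j < n) (z j)^* ^+ b *: v j).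
congr (0 <= _).
under eq_bigr => a _ do under eq_bigr => b _ do
  rewrite linear_sum antidual_eval_suml.
transitivity (\sum_(a < N) \sum_(b < N) \sum_(l < n) \sum_(j < n)
    z l ^+ a * (z j)^* ^+ b * toeplitz_entry M b a (v j) (v l)).
  apply: eq_bigr => a _; apply: eq_bigr => b _.
  rewrite exchange_big; apply: eq_bigr => j _.
  rewrite antidual_eval_sumr; apply: eq_bigr => l _.
  by rewrite linearZ antidual_evalZ antidual_evalZr rmorphXn/= conjCK; ring.
under eq_bigr => a _ do rewrite exchange_big.
rewrite exchange_big; apply: eq_bigr => l _.
under eq_bigr => a _ do rewrite exchange_big.
by rewrite exchange_big.
Qed.

End ToeplitzSeries.

(** * Weak summation of the Toeplitz series *)

Section ToeplitzSum.
Variable R : realType.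
Local Notation C := R[i].
Variables (V : topologicalLmodType C) (M : nat -> 'L(V, antidual V)).
Hypothesis M_pos : forall N, block_positive (toeplitz M N).

Let A : 'L(V, antidual V) := 2^-1 *: (M 0%N + dual_adj (M 0%N)).

Variables (H : hilbertType R) (T : 'L(V, H)).
Hypothesis AT : A = hadj T \oL T.

Let S (k : nat) (z : C) (v w : V) : C^o := \sum_(1 <= n < k) z ^+ n * M n v w.

Let S_linearl k z a u v w : S k z (a *: u + v) w = a * S k z u w + S k z v w.
Proof.
rewrite /S mulr_sumr -big_split; apply: eq_bigr => n _ /=.
by rewrite linearP antidual_evalD antidual_evalZ mulrDr mulrCA.
Qed.

Let S_linearr k z a u v w : S k z w (a *: u + v) = a^* * S k z w u + S k z w v.
Proof.
rewrite /S mulr_sumr -big_split; apply: eq_bigr => n _ /=.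
by rewrite antidual_evalE mulrDr mulrCA.
Qed.

Lemma toeplitz_sum_exists : exists L : C -> V -> V -> C,
  forall z, unit_disk z ->
    [/\ forall v w, (fun k => \sum_(1 <= n < k) z ^+ n * M n v w : C^o) @ \oo
          --> (L z v w : C^o),
        bilinear_for ( *%R) (Num.conj \; *%R) (L z) &
        forall v w, `|L z v w| <= (1 - `|z|)^-1 * `|T v| * `|T w|].
Proof.
have ex_l (p : C * V * V) : exists l : C, unit_disk p.1.1 ->
    (fun k => S k p.1.1 p.1.2 p.2) @ \oo --> (l : C^o) /\
    `|l| <= (1 - `|p.1.1|)^-1 * `|T p.1.2| * `|T p.2|.
  case: p => [[z v] w] /=.
  have [z1|zn] := pselect (unit_disk z); last by exists 0.
  (* The coefficient of index 0 is set to 0: [T] gives no control on the skew part of [M 0], and the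
     series starts at 1. *)
  pose g n := if n is k.+1 then M k.+1 v w else 0.
  have gT n : `|g n| <= `|T v| * `|T w|.
    case: n => [|n]; first by rewrite normr0 mulr_ge0.
    exact: toeplitz_coef_bound.
  have [l gl lb] := power_series_cvg z1 gT.
  exists l => _; split; last by rewrite -mulrA mulrC.
  have -> : (fun k => S k z v w) = fun k => \sum_(0 <= n < k) z ^+ n * g n.
    apply/funext => -[|k]; first by rewrite /S !big_geq.
    rewrite [RHS]big_nat_recl//= mulr0 add0r /S big_add1.
    by apply: eq_bigr.
  exact: gl.
have [l lP] := choice ex_l.
exists (fun z v w => l (z, v, w)) => z zD.
split=> [v w||v w]; last exact: (lP (z, v, w) zD).2.
  exact: (lP (z, v, w) zD).1.
have lS v w := (lP (z, v, w) zD).1.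
(* Linear relations between partial sums pass to the limits by uniqueness; this one statement serves
   both variables. *)
have comb a b u v u' v' w w' :
    (forall k, S k z w w' = a * S k z u u' + b * S k z v v') ->
    l (z, w, w') = a * l (z, u, u') + b * l (z, v, v').
  move=> E; apply: (cvg_unique (@norm_hausdorff _ C^o) (lS w w')).
  rewrite /= (funext E).
  exact: (@cvgD _ C^o _ _ _ _ _ _ _ (@cvgMl_tmp _ _ _ _ _ _ _ (lS u u'))
    (@cvgMl_tmp _ _ _ _ _ _ _ (lS v v'))).
split=> [w a u v|w a u v] /=.
  by rewrite (comb a 1 u v w w) ?mul1r// => k; rewrite mul1r S_linearl.
by rewrite (comb a^* 1 w w u v) ?mul1r// => k; rewrite mul1r S_linearr.
Qed.

End ToeplitzSum.

(** * Dense factorization and the representation of the sum *)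

Lemma dense_factorization (R : realType) (V : tvsType R[i])
    (A : 'L(V, antidual V)) :
  factorization_property V -> positive_op A ->
  exists (H : hilbertType R) (T : 'L(V, H)),
    dense (range T) /\ A = hadj T \oL T.
Proof.
move=> factV /factV[H [T ->]].
exists (csub (closure_range T) : hilbertType R), (corestrict T).
by split; [exact: corestrict_dense | rewrite hadj_corestrict].
Qed.

Theorem theorem4p2 (R : realType) (V : tvsType R[i]) :
  factorization_property V ->
  (forall M : nat -> 'L(V, antidual V),
     (forall N : nat, block_positive (toeplitz M N)) ->
     exists Phi : R[i] -> 'L(V, antidual V),
       [/\ forall z, unit_disk z -> weak_sum M z (Phi z),
           caratheodory_herglotz Phi &
           exists (H0 : hilbertType R) (T0 : 'L(V, H0))
                  (phi : R[i] -> 'L(H0, H0)),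
             [/\ dense (range T0),
                 caratheodory_herglotz_hilbert phi &
                 forall z, unit_disk z ->
                   Phi z = 2^-1 *: (Phi 0 - dual_adj (Phi 0))
                           + hadj T0 \oL phi z \oL T0]]) /\
  (forall (D : 'L(V, antidual V)) (H : hilbertType R) (T : 'L(V, H))
          (phi : R[i] -> 'L(H, H)) (Phi : R[i] -> 'L(V, antidual V)),
     purely_imaginary D ->
     closure (range T) = [set: H] ->
     caratheodory_herglotz_hilbert phi ->
     (forall z, unit_disk z -> Phi z = D + hadj T \oL phi z \oL T) ->
     caratheodory_herglotz Phi).
Proof.
move=> factV; split; last first.
  by move=> D H T phi Phi D0 _; exact: caratheodory_herglotz_comp.
move=> M M_pos.
pose A : 'L(V, antidual V) := 2^-1 *: (M 0%N + dual_adj (M 0%N)).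
have [H0 [T0 [T0_dense AT0]]] : exists (H : hilbertType R) (T : 'L(V, H)),
    dense (range T) /\ A = hadj T \oL T.
  exact: dense_factorization (toeplitz_diag_positive M_pos).
have AE v w : A v w = hdot (T0 v) (T0 w) by rewrite AT0.
have A2 v w : 2 * A v w = M 0%N v w + (M 0%N w v)^*.
  rewrite /A contlin_evalZ antidual_evalZ contlin_evalD antidual_evalD.
  by rewrite dual_adjE mulVKf.
have T0P a u v : T0 (a *: u + v) = a *: T0 u + T0 v.
  exact: contlin_linear.
have [L LP] := toeplitz_sum_exists M_pos AT0.
have ex_phi z : exists m : 'L(H0, H0),
    unit_disk z -> forall v w,
      hdot (m (T0 v)) (T0 w) = hdot (T0 v) (T0 w) + 2 * L z v w.
  have [zD|zn] := pselect (unit_disk z); last by exists 0.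
  have [_ [Ll Lr] Lb] := LP z zD.
  have z0 : 0 <= (1 - `|z|)^-1 by rewrite invr_ge0 subr_ge0 ltW.
  (* In the constant, 1 bounds <T0 v, T0 w> by Cauchy-Schwarz and 2/(1 - |z|) bounds twice the
     series. *)
  have [||v w|m mP] := @form_representation _ _ _ T0 T0_dense
    (fun v w => hdot (T0 v) (T0 w) + 2 * L z v w) (1 + 2 * (1 - `|z|)^-1).
  - by rewrite addr_ge0// mulr_ge0.
  - split=> [w a u v|w a u v]; cbv beta delta [comp].
      rewrite Ll T0P hdotPl [2 * (_ + _)]mulrDr addrACA.
      by rewrite [2 * (a * _)]mulrCA -mulrDr.
    rewrite Lr T0P hdotPr [2 * (_ + _)]mulrDr addrACA.
    by rewrite [2 * (a^* * _)]mulrCA -mulrDr.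
  - rewrite (le_trans (ler_normD _ _))// [(1 + _ / _) * _]mulrDl mul1r.
    rewrite [(`|T0 v| + _) * _]mulrDl lerD//.
      by rewrite hdot_CauchySchwarz.
    by rewrite normrM ger0_norm// -!mulrA ler_wpM2l// mulrA Lb.
  - by exists m => _; exact: mP.
have [phi phiP] := choice ex_phi.
(* The skew part of [M 0], so that [M 0] is the sum of [A] and [D]. *)
pose D : 'L(V, antidual V) := 2^-1 *: (M 0%N - dual_adj (M 0%N)).
have DE v w : D v w = 2^-1 * (M 0%N v w - (M 0%N w v)^*).
  rewrite /D contlin_evalZ antidual_evalZ contlin_evalD antidual_evalD.
  by rewrite contlin_evalN antidual_evalN dual_adjE.
(* Building [Phi] from [phi] makes each [Phi z] a continuous operator at once; [PhiE] then
   identifies it with the weak sum on the disk. *)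
pose Phi z := D + hadj T0 \oL phi z \oL T0.
have PhiE z v w : unit_disk z -> Phi z v w = M 0%N v w + 2 * L z v w.
  move=> zD; rewrite /Phi contlin_evalD antidual_evalD hadj_compE phiP//.
  rewrite -AE addrA.
  congr (_ + _); apply: (@mulfI _ 2) => //.
  rewrite mulrDr A2 DE mulVKf//; ring.
have D_imag : purely_imaginary D.
  apply: contlin_antidual_ext => v w.
  rewrite contlin_evalD antidual_evalD dual_adjE !DE contlin_eval0.
  rewrite rmorphM rmorphB/= conjCK.
  have -> : (2^-1)^* = 2^-1 :> R[i] by rewrite conj_Creal// rpredV realn.
  by rewrite -mulrDr addrA subrK subrr mulr0.
have zero_disk : unit_disk (0 : R[i]) by rewrite /unit_disk/= normr0.
(* Hence [Phi 0] agrees with [M 0], and its skew part is [D]. *)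
have L0 v w : L 0 v w = 0.
  have [/(_ v w) L0cvg _ _] := LP 0 zero_disk.
  apply: (cvg_unique (@norm_hausdorff _ (R[i])^o) L0cvg).
  rewrite (_ : (fun _ => _) = fun=> 0); first exact: cvg_cst.
  apply/funext => k; rewrite big_nat big1// => n /andP[n0 _].
  by rewrite expr0n gtn_eqF// mul0r.
have conjE (x y : R[i]) : (x + 2 * y)^* = x^* + 2 * y^*.
  by rewrite rmorphD rmorphM/= conjC_nat.
(* With [a] the self-adjoint value of [A], the kernel summand of [phi] on the range of [T0] is twice
   that of [toeplitz_herglotz_ge0]. *)
have arith (k a x y : R[i]) :
    2 * (k * (a + x + y)) = k * (a + 2 * x + (a + 2 * y)) by ring.
have phi_herglotz : caratheodory_herglotz_hilbert phi.
  apply: (herglotz_hilbert_dense T0_dense) => n z v zD.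
  have Lc z v w zD := let: And3 c _ _ := LP z zD in c v w.
  have := toeplitz_herglotz_ge0 M_pos Lc v zD; rewrite -/A => ge0.
  have := mulr_ge0 (ler0n _ 2) ge0; congr (0 <= _).
  rewrite mulr_sumr; apply: eq_bigr => l _.
  rewrite mulr_sumr; apply: eq_bigr => j _.
  rewrite !phiP// -!AE conjE.
  have -> : (A (v l) (v j))^* = A (v j) (v l).
    by rewrite !AE [RHS]hermC expr0 mul1r.
  exact: arith.
exists Phi; split.
- move=> z zD v w; rewrite PhiE//.
  have [Lcvg _ _] := LP z zD.
  exact: (@cvgD _ (R[i])^o _ _ _ _ _ _ _ (@cvg_cst (R[i])^o _ _ _ _)
    (@cvgMl_tmp _ _ _ _ _ _ _ (Lcvg v w))).
- exact: (caratheodory_herglotz_comp D_imag phi_herglotz).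
- exists H0, T0, phi; split=> // z zD.
  rewrite [LHS]/Phi; congr (_ + _); apply: contlin_antidual_ext => v w.
  rewrite DE contlin_evalZ antidual_evalZ contlin_evalD antidual_evalD.
  by rewrite contlin_evalN antidual_evalN dual_adjE !PhiE// !L0 mulr0 !addr0.
Qed.
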